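(* Let $F$ be a field of characteristic $3$ and let $B(4,2)=\mathrm{End}_F(V)\oplus V$ be the Hurwitz superalgebra described in the context, with $\{u,v\}$ a basis of $V$ such that $(u,v)=1$ and $e_1,e_2,x,y$ as in the context. The nontrivial gradings on the superalgebra $B(4,2)$ by their universal grading groups are, up to equivalence, the following: (a) the $\mathbb{Z}$-grading (5-grading) $B(4,2)^0=Fe_1\oplus Fe_2$, $B(4,2)^1=Fu$, $B(4,2)^{-1}=Fv$, $B(4,2)^2=Fx$, $B(4,2)^{-2}=Fy$; (b) the $\mathbb{Z}_4$-grading $B(4,2)^{\bar0}=Fe_1\oplus Fe_2$, $B(4,2)^{\bar2}=Fx\oplus Fy$, $B(4,2)^{\bar1}=Fu$, $B(4,2)^{\bar3}=Fv$; (c) the $\mathbb{Z}_3$-grading $B(4,2)^{\bar0}=Fe_1\oplus Fe_2$, $B(4,2)^{\bar1}=Fu\oplus Fy$, $B(4,2)^{\bar2}=Fv\oplus Fx$; (d) the main $\mathbb{Z}_2$-grading $B(4,2)^{\bar0}=\mathrm{End}_F(V)$, $B(4,2)^{\bar1}=V$.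
   Context: Gradings. A grading by a group $G$ on an algebra $\mathcal A$ is a decomposition $\Gamma:\mathcal A=\bigoplus_{g\in G}\mathcal A^g$ into subspaces with $\mathcal A^g\mathcal A^h\subseteq\mathcal A^{gh}$; its support is $\{g:\mathcal A^g\neq0\}$. Its universal grading group is the group generated by the support subject to the relations $g_1g_2=g_3$ whenever $0\neq\mathcal A^{g_1}\mathcal A^{g_2}\subseteq\mathcal A^{g_3}$. A superalgebra is a $\mathbb{Z}_2$-graded algebra $\mathcal A=\mathcal A_{\bar0}\oplus\mathcal A_{\bar1}$; this $\mathbb{Z}_2$-grading is called the main grading. A grading on the superalgebra $\mathcal A$ is a group grading on the algebra $\mathcal A$ such that $\mathcal A^g=(\mathcal A^g\cap\mathcal A_{\bar0})\oplus(\mathcal A^g\cap\mathcal A_{\bar1})$ for all $g$. The trivial grading is $\mathcal A=\mathcal A^e$. Two gradings are equivalent if there is an isomorphism of superalgebras (an algebra isomorphism preserving the main grading) which maps each nonzero homogeneous component of the first grading onto a homogeneous component of the second. All gradings are group gradings (and the support of each grading considered generates an abelian group). The superalgebra $B(4,2)$. Let $V$ be a $2$-dimensional vector space over a field $F$ of characteristic $3$ with a nondegenerate alternating form $(\cdot,\cdot)$. For $\varphi\in\mathrm{End}_F(V)$ put $\bar\varphi=\mathrm{tr}(\varphi)1-\varphi$. Then $B(4,2)=\mathrm{End}_F(V)\oplus V$ with $B(4,2)_{\bar0}=\mathrm{End}_F(V)$, $B(4,2)_{\bar1}=V$, and multiplication: composition of maps in $\mathrm{End}_F(V)$; $v\cdot\varphi=\varphi(v)=\bar\varphi\cdot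 v$ for $\varphi\in\mathrm{End}_F(V)$, $v\in V$; and $u\cdot v\in\mathrm{End}_F(V)$ is the map $w\mapsto(w,u)v$, for $u,v\in V$. Given a basis $\{u,v\}$ of $V$ with $(u,v)=1$, identify $\mathrm{End}_F(V)$ with $\mathcal M_2(F)$ and let $e_1=\begin{pmatrix}1&0\\0&0\end{pmatrix}$, $e_2=\begin{pmatrix}0&0\\0&1\end{pmatrix}$, $x=\begin{pmatrix}0&1\\0&0\end{pmatrix}$, $y=\begin{pmatrix}0&0\\1&0\end{pmatrix}$; thus $u\cdot u=-x$, $v\cdot v=y$, $u\cdot v=-e_2$, $v\cdot u=e_1$. *)

(* Defs.v *)
From HB Require Import structures.
From mathcomp Require Import all_boot all_order all_fingroup all_algebra.

Set Implicit Arguments.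
Unset Strict Implicit.
Unset Printing Implicit Defensive.

Import GRing.Theory.
Local Open Scope ring_scope.

(* The infinite cyclic group: int, with addition as the group law.  (The      *)
(* group law of the finite groups 'Z_n is likewise the addition mod n.)       *)
Definition Zgroup : Type := int.
HB.instance Definition _ := Choice.copy Zgroup int.
HB.instance Definition _ := isGroup.Build Zgroup
  (@addrA int) (@add0r int) (@addr0 int) (@addNr int) (@addrN int).

Record superalgebra (F : fieldType) := Superalgebra {
  sa_space :> vectType F;
  sa_mul : sa_space -> sa_space -> sa_space;
  sa_even : {vspace sa_space};
  sa_odd : {vspace sa_space};
  sa_mul_linearr : forall a, linear (sa_mul a);
  sa_mul_linearl : forall b, linear (sa_mul^~ b);
  sa_full : (sa_even + sa_odd = fullv)%VS;
  sa_direct : directv (sa_even + sa_odd);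
  sa_mul_ee : {in sa_even & sa_even, forall a b, sa_mul a b \in sa_even};
  sa_mul_eo : {in sa_even & sa_odd, forall a b, sa_mul a b \in sa_odd};
  sa_mul_oe : {in sa_odd & sa_even, forall a b, sa_mul a b \in sa_odd};
  sa_mul_oo : {in sa_odd & sa_odd, forall a b, sa_mul a b \in sa_even}
}.

Section Gradings.

Variables (F : fieldType) (A : superalgebra F) (G : groupType).

(* A family of subspaces indexed by G; all but finitely many components of a  *)
(* grading vanish since A is finite-dimensional, so that A = (+)_g Gamma g    *)
(* is expressed through the finite partial sums.                              *)
Record is_grading (Gamma : G -> {vspace A}) : Prop := IsGrading {
  grading_direct : forall s : seq G, uniq s -> directv (\sum_(g <- s) Gamma g);
  grading_full : forall a : A,
    exists s : seq G, uniq s && (a \in \sum_(g <- s) Gamma g)%VS;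
  grading_mul : forall g h a b,
    a \in Gamma g -> b \in Gamma h -> sa_mul a b \in Gamma (g * h)%g
}.

Record is_super_grading (Gamma : G -> {vspace A}) : Prop := IsSuperGrading {
  super_grading_grading : is_grading Gamma;
  super_grading_full : forall g,
    (Gamma g = (Gamma g :&: sa_even A) + (Gamma g :&: sa_odd A))%VS;
  super_grading_direct : forall g,
    directv ((Gamma g :&: sa_even A) + (Gamma g :&: sa_odd A))
}.

Variable Gamma : G -> {vspace A}.

Definition gsupport : pred G := [pred g | Gamma g != 0%VS].

Definition trivial_grading : Prop := Gamma 1%g = fullv.

Inductive generated (S : pred G) : G -> Prop :=
| generated_mem g : S g -> generated S g
| generated_one : generated S 1%g
| generated_mul g h : generated S g -> generated S h -> generated S (g * h)%g
| generated_inv g : generated S g -> generated S g^-1%g.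

Definition abelian_support : Prop :=
  forall g h, generated gsupport g -> generated gsupport h ->
  (g * h = h * g)%g.

(* 0 <> A^g1 A^g2 \subseteq A^g3 *)
Definition support_rel (g1 g2 g3 : G) : Prop :=
  (exists a b, [/\ a \in Gamma g1, b \in Gamma g2 & sa_mul a b != 0]) /\
  (forall a b, a \in Gamma g1 -> b \in Gamma g2 -> sa_mul a b \in Gamma g3).

(* The group generated by the support subject to the relations support_rel,   *)
(* as words in the letters s and s^-1, for s in the support, modulo the       *)
(* congruence univ_eq; (false, s) stands for s and (true, s) for s^-1.        *)
Definition letter : Type := bool * {g : G | gsupport g}.

Inductive univ_eq : seq letter -> seq letter -> Prop :=
| univ_eq_refl w : univ_eq w w
| univ_eq_sym w1 w2 : univ_eq w1 w2 -> univ_eq w2 w1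
| univ_eq_trans w1 w2 w3 : univ_eq w1 w2 -> univ_eq w2 w3 -> univ_eq w1 w3
| univ_eq_cat w1 w2 w1' w2' :
    univ_eq w1 w1' -> univ_eq w2 w2' -> univ_eq (w1 ++ w2) (w1' ++ w2')
| univ_eq_cancel b s : univ_eq [:: (b, s); (~~ b, s)] [::]
| univ_eq_rel s1 s2 s3 : support_rel (val s1) (val s2) (val s3) ->
    univ_eq [:: (false, s1); (false, s2)] [:: (false, s3)].

Definition eval_letter (l : letter) : G :=
  if l.1 then (val l.2)^-1%g else val l.2.

Definition eval_word (w : seq letter) : G := (\prod_(l <- w) eval_letter l)%g.

(* The inclusion of the support into G induces an isomorphism from the        *)
(* universal grading group onto G.                                            *)
Definition is_universal_group : Prop :=
  (forall g, exists w, eval_word w = g) /\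
  (forall w1 w2, eval_word w1 = eval_word w2 <-> univ_eq w1 w2).

End Gradings.

Record is_super_isomorphism (F : fieldType) (A B : superalgebra F)
    (f : 'Hom(A, B)) : Prop := IsSuperIsomorphism {
  super_iso_bij : bijective f;
  super_iso_mul : forall a b, f (sa_mul a b) = sa_mul (f a) (f b);
  super_iso_even : (f @: sa_even A = sa_even B)%VS;
  super_iso_odd : (f @: sa_odd A = sa_odd B)%VS
}.

Definition equivalent_gradings (F : fieldType) (A B : superalgebra F)
    (G H : groupType) (Gamma : G -> {vspace A}) (Delta : H -> {vspace B}) :
    Prop :=
  exists f : 'Hom(A, B), is_super_isomorphism f /\
    forall g, Gamma g != 0%VS -> exists h, (f @: Gamma g)%VS = Delta h.

Section B42.

Variables (F : fieldType) (V : vectType F).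

Definition lfun_trace (phi : 'End(V)) : F :=
  \tr (passmx.mxof (vbasis {:V}) (vbasis {:V}) phi).

Definition lfun_bar (phi : 'End(V)) : 'End(V) := lfun_trace phi *: \1%VF - phi.

Variable form : {biscalar V}.

Definition form_endo (u v : V) : 'End(V) := linfun (fun w => form w u *: v).

(* Since lfun_bar is an involution when \dim V = 2, the rule                  *)
(* bar phi . v = phi v amounts to phi . v = bar phi v.                        *)
Definition B42_mul (a b : 'End(V) * V) : 'End(V) * V :=
  ((a.1 \o b.1)%VF + form_endo a.2 b.2, b.1 a.2 + lfun_bar a.1 b.2).

Definition B42_inE (phi : 'End(V)) : 'End(V) * V := (phi, 0).
Definition B42_inV (v : V) : 'End(V) * V := (0, v).

Fact B42_inE_linear : linear B42_inE.
Proof. by move=> k p q; apply: injective_projections; rewrite /= ?scaler0 ?addr0. Qed.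
Fact B42_inV_linear : linear B42_inV.
Proof. by move=> k p q; apply: injective_projections; rewrite /= ?scaler0 ?addr0. Qed.
HB.instance Definition _ := GRing.isSemilinear.Build F _ _ _ B42_inE
  (GRing.semilinear_linear B42_inE_linear).
HB.instance Definition _ := GRing.isSemilinear.Build F _ _ _ B42_inV
  (GRing.semilinear_linear B42_inV_linear).

Definition B42_even : {vspace 'End(V) * V} := limg (linfun B42_inE).
Definition B42_odd : {vspace 'End(V) * V} := limg (linfun B42_inV).

Fact B42_evenP a : reflect (a.2 = 0) (a \in B42_even).
Proof.
apply: (iffP memv_imgP) => [[p _ ->]|a0]; first by rewrite lfunE.
by exists a.1; rewrite ?memvf // lfunE /= /B42_inE -a0; case: (a).
Qed.

Fact B42_oddP a : reflect (a.1 = 0) (a \in B42_odd).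
Proof.
apply: (iffP memv_imgP) => [[p _ ->]|a0]; first by rewrite lfunE.
by exists a.2; rewrite ?memvf // lfunE /= /B42_inV -a0; case: (a).
Qed.

Fact form_endo_map_linear (u v : V) : linear (fun w : V => form w u *: v).
Proof. by move=> k p q; rewrite linearPl scalerDl scalerA. Qed.

Lemma form_endoE u v w : form_endo u v w = form w u *: v.
Proof.
pose f := fun w : V => form w u *: v.
pose L := GRing.isSemilinear.Build F V V _ f
  (GRing.semilinear_linear (form_endo_map_linear u v)).
pose g : {linear V -> V} := HB.pack f L.
exact: (lfunE g).
Qed.

Fact lfun_bar_linear : linear lfun_bar.
Proof.
move=> k p q; rewrite /lfun_bar.
have ->: lfun_trace (k *: p + q) = k * lfun_trace p + lfun_trace q.
  by rewrite /lfun_trace passmx.mxof_linear raddfD /= mxtraceZ.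
by rewrite scalerDl scalerBr opprD scalerA addrACA.
Qed.

Fact B42_mul_linearr a : linear (B42_mul a).
Proof.
move=> k b c; rewrite /B42_mul; apply: injective_projections => /=.
  apply/lfunP=> w; do !rewrite ?lfunE /= ?form_endoE.
  by rewrite linearP !scalerDr !scalerA mulrC addrACA.
by rewrite add_lfunE scale_lfunE linearP scalerDr addrACA.
Qed.

Fact B42_mul_linearl b : linear (B42_mul^~ b).
Proof.
move=> k a c; rewrite /B42_mul; apply: injective_projections => /=.
  apply/lfunP=> w; do !rewrite ?lfunE /= ?form_endoE.
  by rewrite linearP /= scalerDl scalerDr scalerA addrACA.
by rewrite lfun_bar_linear add_lfunE scale_lfunE linearP scalerDr addrACA.
Qed.

Fact B42_full : (B42_even + B42_odd = fullv)%VS.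
Proof.
apply/eqP; rewrite eqEsubv subvf; apply/subvP=> a _.
have -> : a = (a.1, 0) + (0, a.2).
  by apply: injective_projections; rewrite /= ?addr0 ?add0r.
by apply: memv_add; [apply/B42_evenP | apply/B42_oddP].
Qed.

Fact B42_direct : directv (B42_even + B42_odd).
Proof.
apply/directv_addP/eqP; rewrite -subv0; apply/subvP=> -[p v].
by rewrite memv_cap memv0 => /andP[/B42_evenP /= -> /B42_oddP /= ->].
Qed.

Fact B42_mul_ee : {in B42_even & B42_even, forall a b, B42_mul a b \in B42_even}.
Proof.
move=> a b /B42_evenP a0 /B42_evenP b0; apply/B42_evenP.
by rewrite /= a0 b0 !linear0 addr0.
Qed.

Fact B42_mul_eo : {in B42_even & B42_odd, forall a b, B42_mul a b \in B42_odd}.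
Proof.
move=> a b /B42_evenP a0 /B42_oddP b0; apply/B42_oddP.
rewrite /= a0 b0 comp_lfun0r add0r; apply/lfunP=> w.
by rewrite form_endoE linear0r scale0r lfunE.
Qed.

Fact B42_mul_oe : {in B42_odd & B42_even, forall a b, B42_mul a b \in B42_odd}.
Proof.
move=> a b /B42_oddP a0 /B42_evenP b0; apply/B42_oddP.
rewrite /= a0 b0 comp_lfun0l add0r; apply/lfunP=> w.
by rewrite form_endoE scaler0 lfunE.
Qed.

Fact B42_mul_oo : {in B42_odd & B42_odd, forall a b, B42_mul a b \in B42_even}.
Proof.
move=> a b /B42_oddP a0 /B42_oddP b0; apply/B42_evenP.
have bar0 : lfun_bar 0 = 0.
  by have := lfun_bar_linear (-1) 0 0; rewrite scaler0 addr0 scaleN1r addNr.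
by rewrite /= a0 b0 bar0 !lfunE addr0.
Qed.

Definition B42 : superalgebra F :=
  Superalgebra B42_mul_linearr B42_mul_linearl B42_full B42_direct
    B42_mul_ee B42_mul_eo B42_mul_oe B42_mul_oo.

(* M_2(F) identified with End(V) through the basis {u, v}: the j-th column of *)
(* M holds the coordinates of the image of the j-th basis vector.             *)
Definition mx_endo (u v : V) (M : 'M[F]_2) : 'End(V) :=
  linfun (fun w => \sum_(j < 2) coord [tuple u; v] j w *:
                     \sum_(i < 2) M i j *: [tuple u; v]`_i).

Section ListedGradings.

Variables u v : V.

Definition endo_e1 : 'End(V) := mx_endo u v (delta_mx 0 0).
Definition endo_e2 : 'End(V) := mx_endo u v (delta_mx 1 1).
Definition endo_x : 'End(V) := mx_endo u v (delta_mx 0 1).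
Definition endo_y : 'End(V) := mx_endo u v (delta_mx 1 0).

Definition line_e1 : {vspace B42} := <[B42_inE endo_e1 : B42]>%VS.
Definition line_e2 : {vspace B42} := <[B42_inE endo_e2 : B42]>%VS.
Definition line_x : {vspace B42} := <[B42_inE endo_x : B42]>%VS.
Definition line_y : {vspace B42} := <[B42_inE endo_y : B42]>%VS.
Definition line_u : {vspace B42} := <[B42_inV u : B42]>%VS.
Definition line_v : {vspace B42} := <[B42_inV v : B42]>%VS.

Definition B42_gradingZ (n : Zgroup) : {vspace B42} :=
  (if n == 0 :> int then line_e1 + line_e2
   else if n == 1 :> int then line_u
   else if n == -1 :> int then line_v
   else if n == 2 :> int then line_x
   else if n == -2 :> int then line_y
   else 0)%VS.

Definition B42_gradingZ4 (n : 'Z_4) : {vspace B42} :=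
  nth 0%VS [:: line_e1 + line_e2; line_u; line_x + line_y; line_v]%VS n.

Definition B42_gradingZ3 (n : 'Z_3) : {vspace B42} :=
  nth 0%VS [:: line_e1 + line_e2; line_u + line_y; line_v + line_x]%VS n.

Definition B42_gradingZ2 (n : 'Z_2) : {vspace B42} :=
  nth 0%VS [:: sa_even B42; sa_odd B42] n.

End ListedGradings.

End B42.

(* Main.v *)
Require Import Defs.
From HB Require Import structures.
From mathcomp Require Import all_boot all_order all_fingroup all_algebra.
From mathcomp Require Import ring.
From Stdlib Require Import FunctionalExtensionality.

Set Implicit Arguments.
Unset Strict Implicit.
Unset Printing Implicit Defensive.

Import GRing.Theory.
Local Open Scope ring_scope.

(* Call (u, v) with (u, v) = 1 a frame.  For any g in a group G, giving e1    *)
(* and e2 the degree 1 and u, v, x, y the degrees g, g^-1, g^2, g^-2 yields a *)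
(* grading of B(4,2), and the four listed gradings are the cases where g      *)
(* generates Z, Z_4, Z_3, Z_2.  Conversely, expanding a frame into            *)
(* homogeneous components, bilinearity of the form yields homogeneous vectors *)
(* u', v' of V with (u', v') <> 0, hence a homogeneous frame, up to scaling.  *)
(* As e1 = v' u' is a nonzero idempotent, deg v' = (deg u')^-1: every grading *)
(* is of the above kind for g = deg u'.  Frames are permuted transitively by  *)
(* automorphisms, so only the coincidences among the five degrees matter,     *)
(* i.e. which of g, g^2, g^3, g^4 are 1; this leaves the four listed gradings *)
(* besides the trivial one.  They are told apart by the number of their       *)
(* nonzero components: 5, 4, 3 and 2.                                         *)

(** * Frames *)

(** Everything is computed in frame coordinates. The structure constants ([frame_coef_mul]) are the
    same for all frames and add the exponents 0, 0, 2, -2, 1, -1; hence [frame_is_super_grading],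
    and the map matching coordinates of two frames is an automorphism ([change_frame_iso]).
    [super_grading_frame] brings any grading to this shape, and [frame_grading_equivalent] leaves
    only the equations g^n = 1 with n <= 4 to compare.

    Universality: in the presented group the letter of e1 is trivial, since e1 is idempotent, and
    the products of u, v express the other letters through that of u, so the group is cyclic. Normal
    forms ([universal_group_nf]) identify it with Z, or with Z_4, Z_3, Z_2 once coinciding degrees
    bound the order of the letter of u. *)

Lemma alternating_anti (F : fieldType) (V : vectType F) (form : {biscalar V}) :
  (forall w, form w w = 0) -> forall w1 w2, form w1 w2 = - form w2 w1.
Proof.
move=> form_alt w1 w2; apply/eqP; rewrite -addr_eq0.
have := form_alt (w1 + w2).
by rewrite linearDl !linearDr /= !form_alt add0r addr0 => ->.
Qed.

Lemma symplectic_basis (F : fieldType) (V : vectType F) (form : {biscalar V})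
    (u v : V) :
  \dim {:V} = 2%N -> (forall w, form w w = 0) -> form u v = 1 ->
  basis_of {:V} [:: u; v].
Proof.
move=> dimV form_alt uv1; rewrite basisEfree dimV subvf leqnn !andbT.
rewrite free_cons seq1_free span_seq1; apply/andP; split.
  apply: contra_eqN uv1 => /vlineP[k ->].
  by rewrite linearZl_LR /= form_alt mulr0 eq_sym oner_eq0.
by apply: contra_eq_neq uv1 => ->; rewrite linear0r eq_sym oner_neq0.
Qed.

Section Frame.

Variables (F : fieldType) (V : vectType F) (form : {biscalar V}).
Hypothesis form_alt : forall w, form w w = 0.
Variables u v : V.
Hypotheses (uv_basis : basis_of {:V} [:: u; v]) (uv1 : form u v = 1).

Let vu1 : form v u = -1. Proof. by rewrite alternating_anti // uv1. Qed.

(** Pairing a u + b v with v on the right gives a, and with u on the left gives b. *)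
Lemma symplectic_decomp w : w = form w v *: u + form u w *: v.
Proof.
have [a [b ->]] : exists a b, w = a *: u + b *: v.
  rewrite [w](coord_basis (X := [tuple u; v]) uv_basis (memvf w)).
  by rewrite !big_ord_recl big_ord0 addr0 /=; do 2!eexists.
rewrite linearDl linearDr !linearZl_LR !linearZr_LR /= !form_alt uv1.
by rewrite !mulr0 !mulr1 add0r addr0.
Qed.

Lemma symplectic_coord w :
  coord [tuple u; v] 0 w = form w v /\ coord [tuple u; v] 1 w = form u w.
Proof.
have fr := basis_free uv_basis.
have cu i : coord [tuple u; v] i u = (0 == i)%:R.
  exact: (coord_free (X := [tuple u; v]) 0 i fr).
have cv i : coord [tuple u; v] i v = (1 == i)%:R.
  exact: (coord_free (X := [tuple u; v]) 1 i fr).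
have c i : coord [tuple u; v] i w
         = form w v * (0 == i)%:R + form u w * (1 == i)%:R.
  by rewrite [w in LHS]symplectic_decomp linearD !linearZ /= cu cv.
by rewrite !c /= !mulr0 !mulr1 addr0 add0r.
Qed.

(** The trace is defined through [vbasis]. Splitting each phi e_i along u and v, the coordinates of
    u and v in [vbasis] appear as weights, and summing over i rebuilds phi u and phi v. *)
Lemma lfun_traceE phi : lfun_trace phi = form (phi u) v + form u (phi v).
Proof.
pose e := vbasis {:V}.
have sum_e w : w = \sum_i coord e i w *: e`_i.
  exact: coord_basis (vbasisP _) (memvf w).
have -> : lfun_trace phi = \sum_i coord e i (phi e`_i).
  by apply: eq_bigr => i _; rewrite !mxE /= passmx.vecof_delta.
under eq_bigr do rewrite [phi _]symplectic_decomp linearD !linearZ /=.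
rewrite big_split [in form (phi u)](sum_e u) [in form u (phi v)](sum_e v) /=.
rewrite !linear_sum /= linear_sumlz /=; congr (_ + _); apply: eq_bigr => i _.
  by rewrite linearZ /= linearZl_LR /= mulrC.
by rewrite linearZ /= linearZr_LR /= mulrC.
Qed.

Lemma mx_endoE M w :
  mx_endo u v M w = form w v *: (M 0 0 *: u + M 1 0 *: v)
                    + form u w *: (M 0 1 *: u + M 1 1 *: v).
Proof.
pose f w := \sum_(j < 2) coord [tuple u; v] j w *:
                     \sum_(i < 2) M i j *: [tuple u; v]`_i.
have f_lin : linear f.
  move=> k p q; rewrite /f scaler_sumr -big_split /=; apply: eq_bigr => j _.
  by rewrite linearP scalerDl scalerA.
pose g : {linear V -> V} := HB.pack f
  (GRing.isSemilinear.Build F V V _ f (GRing.semilinear_linear f_lin)).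
have -> : mx_endo u v M w = f w by exact: (lfunE g).
rewrite /f !big_ord_recl !big_ord0 /= !addr0.
have -> : lift ord0 ord0 = 1 :> 'I_2 by apply/val_inj.
by have [-> ->] := symplectic_coord w.
Qed.

(** The order e1, e2, x, y, u, v is the meaning of the indices 0 to 5 from here on. *)
Definition frame : 6.-tuple (B42 form) :=
  [tuple B42_inE (endo_e1 u v) : B42 form; B42_inE (endo_e2 u v);
         B42_inE (endo_x u v); B42_inE (endo_y u v); B42_inV u; B42_inV v].

Definition frame_coef (z : B42 form) : seq F :=
  [:: form (z.1 u) v; form u (z.1 v); form (z.1 v) v; form u (z.1 u);
      form z.2 v; form u z.2].


Lemma symplectic_lfunP (phi psi : 'End(V)) :
  phi u = psi u -> phi v = psi v -> phi = psi.
Proof.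
move=> eq_u eq_v; apply/lfunP=> w.
by rewrite [w]symplectic_decomp !linearD !linearZ /= eq_u eq_v.
Qed.

Let zeroE := (scale1r, scale0r, scaler0, addr0, add0r).

Lemma endo_e1E w : endo_e1 u v w = form w v *: u.
Proof. by rewrite mx_endoE !mxE /= !zeroE. Qed.

Lemma endo_e2E w : endo_e2 u v w = form u w *: v.
Proof. by rewrite mx_endoE !mxE /= !zeroE. Qed.

Lemma endo_xE w : endo_x u v w = form u w *: u.
Proof. by rewrite mx_endoE !mxE /= !zeroE. Qed.

Lemma endo_yE w : endo_y u v w = form w v *: v.
Proof. by rewrite mx_endoE !mxE /= !zeroE. Qed.

Let endoE := (endo_e1E, endo_e2E, endo_xE, endo_yE).
Let formE := (form_alt, uv1, vu1).

Lemma frame_sum z : z = \sum_(i < 6) (frame_coef z)`_i *: frame`_i.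
Proof.
rewrite !big_ord_recl big_ord0 addr0 /=; apply: injective_projections => /=.
  rewrite !scaler0 !addr0.
  apply: symplectic_lfunP; do !rewrite ?lfunE /=; rewrite !endoE !formE.
    by rewrite !scale0r !scale1r !scaler0 !add0r -symplectic_decomp.
  by rewrite !scale0r !scale1r !scaler0 !add0r addr0 addrC -symplectic_decomp.
by rewrite !scaler0 !add0r -symplectic_decomp.
Qed.

Lemma frame_is_basis : basis_of {:B42 form} frame.
Proof.
rewrite basisEdim; apply/andP; split.
  apply/subvP => z _; rewrite [z]frame_sum memv_suml // => i _.
  by apply/memvZ/memv_span/mem_nth; rewrite size_tuple.
rewrite size_tuple dimvf /=.
have := size_basis (n := 2) (X := [tuple u; v]) uv_basis; rewrite dimvf => dimV.
by have -> : dim (B42 form) = (dim V * dim V + dim V)%N by []; rewrite dimV.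
Qed.

Lemma frame_coordE z i : coord frame i z = (frame_coef z)`_i.
Proof.
by rewrite [z in LHS]frame_sum coord_sum_free ?(basis_free frame_is_basis).
Qed.

(** The multiplication table, whose right-hand side does not mention the frame: this is why all
    frames look alike to the algebra. *)
Lemma frame_coef_mul a b (p := frame_coef a) (q := frame_coef b) :
  frame_coef (sa_mul a b) =
  [:: p`_0 * q`_0 + p`_2 * q`_3 + p`_5 * q`_4;
      p`_1 * q`_1 + p`_3 * q`_2 - p`_4 * q`_5;
      p`_0 * q`_2 + p`_2 * q`_1 - p`_4 * q`_4;
      p`_3 * q`_0 + p`_1 * q`_3 + p`_5 * q`_5;
      p`_4 * q`_0 + p`_5 * q`_2 + p`_1 * q`_4 - p`_2 * q`_5;
      p`_4 * q`_3 + p`_5 * q`_1 - p`_3 * q`_4 + p`_0 * q`_5].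
Proof.
rewrite {}/p {}/q /= /B42_mul /frame_coef /= /lfun_bar lfun_traceE.
case: a b => [phi a] [psi b] /=.
rewrite !(add_lfunE, comp_lfunE, scale_lfunE, opp_lfunE, id_lfunE) !form_endoE.
have fDl w1 w2 w3 : form (w1 + w2) w3 = form w1 w3 + form w2 w3.
  exact: linearDl.
have fDr w1 w2 w3 : form w3 (w1 + w2) = form w3 w1 + form w3 w2.
  exact: linearDr.
have fZl k w1 w2 : form (k *: w1) w2 = k * form w1 w2 by exact: linearZl_LR.
have fZr k w1 w2 : form w2 (k *: w1) = k * form w2 w1 by exact: linearZr_LR.
have fNl w1 w2 : form (- w1) w2 = - form w1 w2 by exact: linearNl.
have fNr w1 w2 : form w2 (- w1) = - form w2 w1 by exact: linearNr.
(* Reducing every value of an endomorphism to those at u and v turns the goal into polynomial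
   identities between scalars. *)
have evalE (chi : 'End(V)) w : chi w = form w v *: chi u + form u w *: chi v.
  by rewrite [w in LHS]symplectic_decomp linearD !linearZ.
rewrite !(evalE phi (psi _)) (evalE psi a) (evalE phi b).
rewrite !(fDl, fDr, fNl, fNr, fZl, fZr).
rewrite (alternating_anti form_alt v).
by congr [:: _; _; _; _; _; _]; ring.
Qed.

End Frame.

(** * Gradings, universal groups and homogeneous bases *)

Section GradingTheory.

Variables (F : fieldType) (A : superalgebra F) (G : groupType).
Variable Gamma : G -> {vspace A}.
Hypothesis Gamma_grading : is_grading Gamma.

Lemma grading_disjoint g h : g != h -> (Gamma g :&: Gamma h = 0)%VS.
Proof.
move=> neq_gh; have := grading_direct Gamma_grading (s := [:: g; h]).
rewrite /= inE neq_gh directvE /= !big_cons !big_nil addv0 addn0.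
by move=> /(_ isT) dim_gh; apply/directv_addP.
Qed.

Lemma grading_degree_inj g h a :
  a \in Gamma g -> a \in Gamma h -> a != 0 -> g = h.
Proof.
move=> a_g a_h; apply: contra_neq_eq => /grading_disjoint gh0.
by apply/eqP; rewrite -memv0 -gh0 memv_cap a_g.
Qed.

(** A nonzero product lies in both components, so their degrees agree. *)
Lemma support_rel_mul g1 g2 g3 : support_rel Gamma g1 g2 g3 -> (g1 * g2)%g = g3.
Proof.
move=> [[a [b [a1 b2 ab_neq0]]] /(_ a b a1 b2) ab3].
exact: grading_degree_inj (grading_mul Gamma_grading a1 b2) ab3 ab_neq0.
Qed.

Lemma eval_word_cat (w1 w2 : seq (letter Gamma)) :
  eval_word (w1 ++ w2) = (eval_word w1 * eval_word w2)%g.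
Proof. exact: big_cat. Qed.

Lemma univ_eq_eval (w1 w2 : seq (letter Gamma)) :
  univ_eq w1 w2 -> eval_word w1 = eval_word w2.
Proof.
elim=> {w1 w2} //.
- by move=> w1 w2 w3 _ -> _ ->.
- by move=> w1 w2 w1' w2' _ e1 _ e2; rewrite !eval_word_cat e1 e2.
- move=> b s; rewrite /eval_word !big_cons big_nil mulg1 /eval_letter /=.
  by case: b; rewrite (mulVg, mulgV).
- move=> s1 s2 s3 /support_rel_mul s12.
  by rewrite /eval_word !big_cons !big_nil !mulg1.
Qed.

(** In the presented group, s = s s s^-1 = s s^-1 = 1. *)
Lemma univ_eq_idem (s : {g | gsupport Gamma g}) :
  support_rel Gamma (val s) (val s) (val s) ->
  univ_eq [:: (false, s) : letter Gamma] [::].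
Proof.
move=> rel_s.
apply: (univ_eq_trans (w2 := [:: (false, s); (false, s)] ++ [:: (true, s)])).
  rewrite -[X in univ_eq X _]cats0.
  rewrite -[X in univ_eq _ X]/([:: (false, s)] ++ [:: (false, s); (true, s)]).
  apply: univ_eq_cat; first exact: univ_eq_refl.
  exact/univ_eq_sym/univ_eq_cancel.
apply: univ_eq_trans (univ_eq_cancel false s).
rewrite -[X in univ_eq _ X]/([:: (false, s)] ++ [:: (true, s)]).
by apply: univ_eq_cat; [exact: univ_eq_rel | exact: univ_eq_refl].
Qed.

Section NormalForm.

Variable nf : G -> seq (letter Gamma).

(** [nf] picks a word for each group element; compatibility says that right multiplication by s on
    normal forms is derivable from the relations. *)
Definition nf_compatible (s : {g | gsupport Gamma g}) : Prop :=
  forall g, univ_eq (nf g ++ [:: (false, s)]) (nf (g * val s)%g).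

Lemma nf_compatible_mul s1 s2 s3 :
  support_rel Gamma (val s1) (val s2) (val s3) ->
  nf_compatible s1 -> nf_compatible s2 -> nf_compatible s3.
Proof.
move=> rel3 nf1 nf2 g; rewrite -(support_rel_mul rel3) mulgA.
apply: univ_eq_trans (nf2 (g * val s1)%g).
apply: univ_eq_trans (univ_eq_cat (nf1 g) (univ_eq_refl [:: (false, s2)])).
rewrite -catA; apply/univ_eq_cat; first exact: univ_eq_refl.
exact/univ_eq_sym/univ_eq_rel.
Qed.

(** Appending s2 at g amounts to appending s1 s2, that is s3, at g s1^-1. *)
Lemma nf_compatible_divl s1 s2 s3 :
  support_rel Gamma (val s1) (val s2) (val s3) ->
  nf_compatible s1 -> nf_compatible s3 -> nf_compatible s2.
Proof.
move=> rel3 nf1 nf3 g.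
have -> : (g * val s2 = g * (val s1)^-1 * val s3)%g.
  by rewrite -(support_rel_mul rel3) mulgA mulgVK.
apply: univ_eq_trans (nf3 _).
apply: (univ_eq_trans (w2 := nf (g * (val s1)^-1)%g ++ [:: (false, s1); (false, s2)])).
  rewrite -[[:: _; _]]cat1s catA; apply/univ_eq_cat; last exact: univ_eq_refl.
  apply: univ_eq_sym; rewrite -[X in univ_eq _ (nf X)](mulgVK (val s1) g).
  exact: nf1.
by apply/univ_eq_cat; [exact: univ_eq_refl | exact: univ_eq_rel].
Qed.

Lemma nf_compatible_idem s :
  support_rel Gamma (val s) (val s) (val s) -> nf_compatible s.
Proof.
move=> rel_s g; have -> : val s = 1%g.
  by apply: (mulgI (val s)); rewrite mulg1 (support_rel_mul rel_s).
rewrite mulg1 -[X in univ_eq _ X]cats0; apply: univ_eq_cat.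
  exact: univ_eq_refl.
exact: univ_eq_idem.
Qed.

(** Absorbing letters one at a time from the left, every word becomes equal to the normal form of
    its value, so words with equal values are equal in the presented group. *)
Lemma universal_group_nf :
  (forall g, eval_word (nf g) = g) -> univ_eq (nf 1%g) [::] ->
  (forall s, nf_compatible s) -> is_universal_group Gamma.
Proof.
move=> nf_eval nf1 nf_all.
have nfP w : univ_eq w (nf (eval_word w)).
  elim/last_ind: w => [|w [b s] IHw].
    by rewrite /eval_word big_nil; apply: univ_eq_sym.
  rewrite -cats1; apply: (univ_eq_trans (w2 := nf (eval_word w) ++ [:: (b, s)])).
    by apply/univ_eq_cat => //; apply: univ_eq_refl.
  rewrite eval_word_cat; move: (eval_word w) => g.
  rewrite /eval_word big_seq1 /eval_letter /=; case: b; last exact: nf_all.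
  (* For an inverse letter, [nf g] is first replaced by [nf] of g s^-1 followed by s, and then s
     s^-1 cancels. *)
  rewrite -[X in univ_eq _ X]cats0.
  apply: univ_eq_trans
    (univ_eq_cat (univ_eq_refl _) (univ_eq_cancel false s)).
  rewrite -[[:: _; _]]cat1s catA; apply/univ_eq_cat; last exact: univ_eq_refl.
  apply: univ_eq_sym; rewrite -[X in univ_eq _ (nf X)](mulgVK (val s) g).
  exact: nf_all.
split=> [g|w1 w2]; first by exists (nf g).
split=> [eq_w|]; last exact: univ_eq_eval.
by apply: univ_eq_trans (nfP w1) _; rewrite eq_w; apply: univ_eq_sym.
Qed.

End NormalForm.

End GradingTheory.

(** * Gradings spanned by a basis with prescribed degrees *)

Section BasisGrading.

Variables (F : fieldType) (A : vectType F) (G : groupType) (n : nat).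
Variables (X : n.-tuple A) (d : 'I_n -> G).
Hypothesis X_basis : basis_of {:A} X.

Definition basis_grading (g : G) : {vspace A} :=
  (\sum_(i < n | d i == g) <[X`_i]>)%VS.

Lemma mem_basis_gradingP g z :
  reflect (forall i, d i != g -> coord X i z = 0) (z \in basis_grading g).
Proof.
apply: (iffP memv_sumP) => [[a a_line ->] i ne_ig | coord0].
  rewrite linear_sum /= big1 // => j /[dup] /eqP dj /a_line /vlineP[k ->].
  rewrite linearZ /= coord_free ?(basis_free X_basis) //.
  by case: (eqVneq j i) ne_ig => [<-|]; rewrite ?mulr0 // dj eqxx.
exists (fun i => coord X i z *: X`_i) => [i _|]; first exact/memvZ/memv_line.
rewrite {1}[z](coord_basis X_basis (memvf z)) [RHS]big_mkcond /=.
by apply: eq_bigr => i _; case: ifPn => // /coord0 ->; rewrite scale0r.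
Qed.

Lemma mem_basis_grading (i : 'I_n) : X`_i \in basis_grading (d i).
Proof.
apply/mem_basis_gradingP => j; rewrite coord_free ?(basis_free X_basis) //.
by case: (eqVneq i j) => // ->; rewrite eqxx.
Qed.

(* [directv] reads its argument up to unfolding, and would decompose          *)
(* [basis_grading g] further into lines; hence the explicit dimensions.       *)
Lemma basis_grading_direct (s : seq G) :
  uniq s ->
  \dim (\sum_(g <- s) basis_grading g)
  = (\sum_(g <- s) \dim (basis_grading g))%N.
Proof.
elim: s => [|g s IHs] /=.
  by rewrite !big_nil dimv0.
move=> /andP[g_s /IHs IH]; rewrite !big_cons -IH.
apply: dimv_disjoint_sum. apply/eqP;  rewrite -subv0; apply/subvP => z.
rewrite memv_cap memv0 => /andP[/mem_basis_gradingP zg z_s].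
rewrite [z](coord_basis X_basis (memvf z)) big1 // => i _.
have [di|/zg->] := eqVneq (d i) g; last by rewrite scale0r.
suff -> : coord X i z = 0 by rewrite scale0r.
move: z_s; rewrite big_tnth => /memv_sumP[a a_h ->].
rewrite linear_sum big1 // => j _; apply: (mem_basis_gradingP _ _ (a_h j isT)).
by rewrite di; apply: contraNneq g_s => ->; apply: mem_tnth.
Qed.

Lemma basis_grading_full (z : A) :
  exists s : seq G, uniq s && (z \in \sum_(g <- s) basis_grading g)%VS.
Proof.
exists (undup [seq d i | i <- enum 'I_n]); rewrite undup_uniq /=.
rewrite [z](coord_basis X_basis (memvf z)); apply: memv_suml => i _.
have di : d i \in undup [seq d i | i <- enum 'I_n].
  by rewrite mem_undup map_f // mem_enum.
rewrite (bigD1_seq _ di (undup_uniq _)) /=.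
by apply/(subvP (addvSl _ _))/memvZ/mem_basis_grading.
Qed.

Lemma basis_grading_eq0 g : (basis_grading g == 0%VS) = (g \notin codom d).
Proof.
apply/idP/idP => [/eqP g0|g_d].
  apply/codomP => -[i di]; have := mem_basis_grading i.
  rewrite -di g0 memv0 => /eqP Xi0; have := free_not0 (basis_free X_basis).
  by move=> /(_ X`_i); rewrite mem_nth ?size_tuple // Xi0 eqxx => /(_ isT).
rewrite /basis_grading big1 // => i /eqP di.
by rewrite -di codom_f in g_d.
Qed.

End BasisGrading.

(** The degrees of a homogeneous basis determine the grading: in the expansion of z in Gamma g, the
    terms of other degrees sum to an element lying both in Gamma g and in the sum of the other
    components, hence to 0. *)
Lemma grading_of_basis (F : fieldType) (A : superalgebra F) (G : groupType)
    (Gamma : G -> {vspace A}) n (X : n.-tuple A) (d : 'I_n -> G) :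
  is_grading Gamma -> basis_of {:A} X -> (forall i : 'I_n, X`_i \in Gamma (d i)) ->
  Gamma =1 basis_grading X d.
Proof.
move=> Gamma_grading X_basis X_d g; apply/eqP; rewrite eqEsubv andbC.
apply/andP; split; first by apply/subv_sumP => i /eqP <-; rewrite -memvE.
apply/subvP => z z_g; rewrite [z](coord_basis X_basis (memvf z)).
rewrite (bigID (fun i => d i == g)) /=.
set z1 := \sum_(i | _) _; set z2 := \sum_(i | _) _.
have z1_g : z1 \in basis_grading X d g.
  by apply: memv_sumr => i _; apply/memvZ/memv_line.
suff -> : z2 = 0 by rewrite addr0.
have z2_g : z2 \in Gamma g.
  have -> : z2 = z - z1.
    rewrite [z in RHS](coord_basis X_basis (memvf z)).
    by rewrite (bigID (fun i => d i == g)) /= addrAC subrr add0r.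
  rewrite memvB //; apply: memv_suml => i /eqP <-; exact/memvZ/X_d.
pose s := undup [seq d i | i <- enum 'I_n & d i != g].
have g_s : g \notin s.
  rewrite mem_undup; apply/mapP => -[i].
  by rewrite mem_filter => /andP[/eqP ne _] /esym.
have := grading_direct Gamma_grading (s := g :: s).
rewrite /= g_s undup_uniq => /(_ isT).
rewrite directvE /= !big_cons => dim_s.
have dx : (Gamma g :&: \sum_(h <- s) Gamma h = 0)%VS.
  apply/directv_addP; rewrite directvE /= (eqP dim_s).
  have s_uniq : uniq s by exact: undup_uniq.
  by have := grading_direct Gamma_grading s_uniq; rewrite directvE /= => /eqP ->.
apply/eqP; rewrite -memv0 -dx memv_cap z2_g; apply: memv_suml => i ne_ig.
have di : d i \in s by rewrite mem_undup map_f // mem_filter ne_ig mem_enum.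
rewrite (bigD1_seq _ di (undup_uniq _)) /=.
by apply/(subvP (addvSl _ _))/memvZ/X_d.
Qed.

(** * The gradings attached to a frame *)

Section FrameDegree.

Variables (G : groupType) (g : G).

(* The exponents 0, 0, 2, -2, 1, -1 of the degrees of e1, e2, x, y, u, v,     *)
(* shifted by 2 so as to be natural numbers.                                  *)
Definition shifted_degree (i : nat) : nat := nth 0 [:: 2; 2; 4; 0; 3; 1]%N i.

Definition frame_degree (i : nat) : G := (g ^+ shifted_degree i * g ^- 2)%g.

(** The 2 in the hypothesis balances two shifts on the left against one on the right. *)
Lemma frame_degreeM i j k :
  (shifted_degree i + shifted_degree j = shifted_degree k + 2)%N ->
  (frame_degree i * frame_degree j)%g = frame_degree k.
Proof.
move=> eq_ijk; have com n : commute (g ^- 2)%g (g ^+ n)%g.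
  by apply/commute_sym/commuteV/commuteX2/commute_refl.
rewrite /frame_degree mulgA -(mulgA (g ^+ _)%g) com mulgA -expgnDr eq_ijk.
by rewrite expgnDr mulgK.
Qed.

Lemma frame_degreeE :
  [/\ frame_degree 0 = 1, frame_degree 2 = g * g, frame_degree 3 = (g * g)^-1,
      frame_degree 4 = g & frame_degree 5 = g^-1]%g.
Proof.
rewrite /frame_degree /= expg0 expg1 mul1g !(expgS, expg0, mulg1).
by rewrite !invMg; split; rewrite // ?mulgA ?mulgK ?mulgV ?mul1g.
Qed.

Lemma frame_degree_eq i j : (shifted_degree i <= shifted_degree j)%N ->
  (frame_degree i == frame_degree j)
  = (g ^+ (shifted_degree j - shifted_degree i) == 1)%g.
Proof.
move=> le_ij; rewrite (inj_eq (mulIg _)) -{1}(subnK le_ij) expgnDr.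
by rewrite -{1}[(g ^+ shifted_degree i)%g]mul1g (inj_eq (mulIg _)) eq_sym.
Qed.

End FrameDegree.

(** Two exponents differ by at most 4, so coincidences among degrees only see the powers up to the
    fourth. *)
Lemma eq_frame_degree (G H : groupType) (g : G) (h : H) (i j : 'I_6) :
  (forall n, (n <= 4)%N -> (g ^+ n == 1)%g = (h ^+ n == 1)%g) ->
  (frame_degree g i == frame_degree g j)
  = (frame_degree h i == frame_degree h j).
Proof.
move=> eq_gh; wlog le_ij: i j / (shifted_degree i <= shifted_degree j)%N.
  move=> eq_le; case/orP: (leq_total (shifted_degree i) (shifted_degree j)).
    exact: eq_le.
  by move=> /eq_le; rewrite ![frame_degree _ j == _]eq_sym.
rewrite !frame_degree_eq // eq_gh // (leq_trans (leq_subr _ _)) //.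
by case: j {le_ij} => -[|[|[|[|[|[|]]]]]].
Qed.

Section FrameGrading.

Variables (F : fieldType) (V : vectType F) (form : {biscalar V}).
Hypothesis form_alt : forall w, form w w = 0.
Variables u v : V.
Hypotheses (uv_basis : basis_of {:V} [:: u; v]) (uv1 : form u v = 1).
Variables (G : groupType) (g : G).

Notation X := (frame form u v).

Definition frame_grading (k : G) : {vspace B42 form} :=
  basis_grading X (frame_degree g) k.

Let X_basis : basis_of {:B42 form} X.
Proof. exact: frame_is_basis. Qed.

Lemma mem_frame_gradingP k z :
  reflect (forall i : 'I_6, frame_degree g i != k -> (frame_coef u v z)`_i = 0)
          (z \in frame_grading k).
Proof.
apply: (iffP (mem_basis_gradingP _ X_basis _ _)) => + i => /(_ i).
  by rewrite frame_coordE.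
by rewrite frame_coordE.
Qed.

(** If both factors were nonzero, k and l would be the degrees of the i-th and j-th basis vectors,
    making k l the degree of the m-th. *)
Lemma frame_coef_mul_eq0 k l a b i j m :
  a \in frame_grading k -> b \in frame_grading l ->
  (i < 6)%N -> (j < 6)%N ->
  (shifted_degree i + shifted_degree j == shifted_degree m + 2)%N ->
  frame_degree g m != (k * l)%g ->
  (frame_coef u v a)`_i * (frame_coef u v b)`_j = 0.
Proof.
move=> /mem_frame_gradingP a_k /mem_frame_gradingP b_l i6 j6 /eqP eq_ijm ne_m.
have [ik|/(a_k (Ordinal i6))->] := eqVneq (frame_degree g i) k;
  last by rewrite mul0r.
have [jl|/(b_l (Ordinal j6))->] := eqVneq (frame_degree g j) l;
  last by rewrite mulr0.
by rewrite -(frame_degreeM g eq_ijm) ik jl eqxx in ne_m.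
Qed.

Lemma frame_is_grading : is_grading frame_grading.
Proof.
split.
- move=> s s_uniq; rewrite directvE /=; apply/eqP.
  exact: basis_grading_direct.
- exact: basis_grading_full.
- move=> k l a b a_k b_l; apply/mem_frame_gradingP => m ne_m.
  have z i j : (i < 6)%N -> (j < 6)%N ->
      (shifted_degree i + shifted_degree j == shifted_degree m + 2)%N ->
      (frame_coef u v a)`_i * (frame_coef u v b)`_j = 0.
    by move=> i6 j6 e; apply: frame_coef_mul_eq0 a_k b_l i6 j6 e ne_m.
  rewrite frame_coef_mul //; move: z {ne_m}.
  (* Each monomial p_i q_j in entry m of the multiplication table has exponents adding up to that of
     m; [z] checks this by computation. *)
  case: m => -[|[|[|[|[|[|//]]]]]] ? z;
  by rewrite -[nth _ _ _]/(_ + _) !z // ?oppr0 ?addr0.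
Qed.

(** The even part keeps coordinates 0 to 3 and the odd part 4 and 5; setting the others to 0
    preserves the vanishing conditions. *)
Lemma frame_grading_parts k z : z \in frame_grading k ->
  B42_inE z.1 \in frame_grading k /\ B42_inV z.2 \in frame_grading k.
Proof.
move=> /mem_frame_gradingP z_k.
split; apply/mem_frame_gradingP => i /z_k; case: i => -[|[|[|[|[|[|//]]]]]] ? //= _.
- by rewrite linear0l.
- by rewrite linear0r.
- by rewrite lfunE /= linear0l.
- by rewrite lfunE /= linear0r.
- by rewrite lfunE /= linear0l.
- by rewrite lfunE /= linear0r.
Qed.

Lemma frame_is_super_grading : is_super_grading frame_grading.
Proof.
split=> [|k|k]; first exact: frame_is_grading.
  apply/eqP; rewrite eqEsubv subv_add !capvSl !andbT.
  apply/subvP => z /frame_grading_parts[z1_k z2_k].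
  have -> : z = B42_inE z.1 + B42_inV z.2.
    by apply: injective_projections; rewrite /= ?addr0 ?add0r.
  by apply: memv_add; rewrite memv_cap ?z1_k ?z2_k;
    [apply/B42_evenP | apply/B42_oddP].
apply/directv_addP/eqP; rewrite -subv0 -(directv_addP (B42_direct V)).
by apply: capvS; apply: capvSr.
Qed.

Lemma frame_neq0 (i : 'I_6) : X`_i != 0.
Proof. by apply: (basis_not0 X_basis); rewrite mem_nth ?size_tuple. Qed.

Lemma frame_grading_nontrivial : g != 1%g -> ~ trivial_grading frame_grading.
Proof.
move=> g_neq1 Gamma1; have := memvf (B42_inV u : B42 form).
rewrite -Gamma1 => /mem_frame_gradingP/(_ 4) /=.
have [_ _ _ -> _] := frame_degreeE g.
by move=> /(_ g_neq1)/eqP; rewrite uv1 oner_eq0.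
Qed.

End FrameGrading.

Lemma lfun_img_eq (F : fieldType) (A B : vectType F) (f : 'Hom(A, B))
    (U : {vspace A}) (W : {vspace B}) :
  bijective f -> (forall z, (z \in U) = (f z \in W)) -> (f @: U = W)%VS.
Proof.
case=> f' fK f'K fU; apply/eqP; rewrite eqEsubv; apply/andP.
split; apply/subvP => z.
  by case/memv_imgP => y y_U ->; rewrite -fU.
by move=> z_W; rewrite -[z]f'K memv_img // fU f'K.
Qed.

Section FrameProducts.

Variables (F : fieldType) (V : vectType F) (form : {biscalar V}).
Hypothesis form_alt : forall w, form w w = 0.
Variables u v : V.
Hypotheses (uv_basis : basis_of {:V} [:: u; v]) (uv1 : form u v = 1).

Notation X := (frame form u v).

Lemma frame_coef_inj : injective (@frame_coef _ _ form u v).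
Proof.
move=> a b eq_ab.
by rewrite [a](frame_sum form_alt uv_basis uv1) eq_ab -frame_sum.
Qed.

Lemma mem_B42_even z : (z \in B42_even V) =
  all (fun i => (frame_coef u v (z : B42 form))`_i == 0) [:: 4; 5]%N.
Proof.
apply/B42_evenP/idP => /= [->|/and3P[/eqP z4 /eqP z5 _]].
  by rewrite linear0l linear0r eqxx.
by rewrite [z.2](symplectic_decomp form_alt uv_basis uv1) z4 z5 !scale0r addr0.
Qed.

Lemma mem_B42_odd z : (z \in B42_odd V) =
  all (fun i => (frame_coef u v (z : B42 form))`_i == 0) [:: 0; 1; 2; 3]%N.
Proof.
apply/B42_oddP/idP => /= [->|/and5P[/eqP z0 /eqP z1 /eqP z2 /eqP z3 _]].
  by rewrite !lfunE /= !linear0l !linear0r eqxx.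
apply: (symplectic_lfunP form_alt uv_basis uv1); rewrite lfunE /=.
  rewrite [z.1 u](symplectic_decomp form_alt uv_basis uv1) z0 z3.
  by rewrite !scale0r addr0.
rewrite [z.1 v](symplectic_decomp form_alt uv_basis uv1) z1 z2.
by rewrite !scale0r addr0.
Qed.

(** These products serve twice: as relations of the universal group, and to force the degrees of all
    basis vectors from those of u and v. *)
Lemma frame_products :
  [/\ sa_mul X`_0 X`_0 = X`_0, sa_mul X`_2 X`_3 = X`_0 &
   [/\ sa_mul X`_4 X`_4 = - X`_2, sa_mul X`_5 X`_5 = X`_3,
       sa_mul X`_4 X`_5 = - X`_1 & sa_mul X`_5 X`_4 = X`_0]].
Proof.
have vu1 : form v u = -1 by rewrite (alternating_anti form_alt) uv1.
have endoE := (endo_e1E form_alt uv_basis uv1, endo_e2E form_alt uv_basis uv1,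
  endo_xE form_alt uv_basis uv1, endo_yE form_alt uv_basis uv1).
by do 2?split; apply: frame_coef_inj;
  rewrite (frame_coef_mul form_alt uv_basis uv1) /frame_coef /= ?lfunE /=;
  rewrite ?(endoE, vu1, uv1, form_alt, scale1r, scale0r, linear0l, linear0r,
            linearNl, linearNr, oppr0) /=;
  rewrite ?(mulr0, mul0r, mulr1, addr0, add0r, oppr0, opprK, vu1, uv1, form_alt).
Qed.

End FrameProducts.

(** * Equivalence and supports *)

Section ChangeOfFrame.

Variables (F : fieldType) (V : vectType F) (form : {biscalar V}).
Hypothesis form_alt : forall w, form w w = 0.
Variables u' v' u v : V.
Hypotheses (uv'_basis : basis_of {:V} [:: u'; v']) (uv'1 : form u' v' = 1).
Hypotheses (uv_basis : basis_of {:V} [:: u; v]) (uv1 : form u v = 1).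

Definition change_frame_fun (z : B42 form) : B42 form :=
  \sum_(i < 6) coord (frame form u' v') i z *: (frame form u v)`_i.

Fact change_frame_linear : linear change_frame_fun.
Proof.
move=> k a b; rewrite /change_frame_fun scaler_sumr -big_split /=.
by apply: eq_bigr => i _; rewrite linearP scalerDl scalerA.
Qed.

HB.instance Definition _ := GRing.isSemilinear.Build F _ _ _ change_frame_fun
  (GRing.semilinear_linear change_frame_linear).

Definition change_frame : 'Hom(B42 form, B42 form) := linfun change_frame_fun.

Lemma frame_coef_change z :
  frame_coef u v (change_frame z) = frame_coef u' v' z.
Proof.
apply: (@eq_from_nth _ 0) => // i i6; rewrite -[i]/(val (Ordinal (i6 : i < 6)%N)).
rewrite -(frame_coordE form_alt uv_basis uv1) lfunE /=.
rewrite coord_sum_free; last exact/basis_free/frame_is_basis.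
by rewrite (frame_coordE form_alt).
Qed.

End ChangeOfFrame.

Section FrameEquivalence.

Variables (F : fieldType) (V : vectType F) (form : {biscalar V}).
Hypothesis form_alt : forall w, form w w = 0.
Variables u' v' u v : V.
Hypotheses (uv'_basis : basis_of {:V} [:: u'; v']) (uv'1 : form u' v' = 1).
Hypotheses (uv_basis : basis_of {:V} [:: u; v]) (uv1 : form u v = 1).

Notation f := (change_frame form u' v' u v).

Let f_coef z : frame_coef u v (f z) = frame_coef u' v' z.
Proof. exact: frame_coef_change. Qed.

(** The map preserves coordinates, and both the product and the parity are given by the same
    coordinate formulas in the two frames. *)
Lemma change_frame_iso : @is_super_isomorphism F (B42 form) (B42 form) f.
Proof.
have f_bij : bijective f.
  exists (change_frame form u v u' v') => z.
    by apply: (frame_coef_inj form_alt uv'_basis uv'1); rewrite !frame_coef_change.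
  by apply: (frame_coef_inj form_alt uv_basis uv1); rewrite !frame_coef_change.
split=> // [a b||].
- apply: (frame_coef_inj form_alt uv_basis uv1).
  by rewrite f_coef !(frame_coef_mul form_alt) // !f_coef.
- apply: lfun_img_eq => // z.
  rewrite (mem_B42_even form_alt uv_basis uv1 (f z)).
  by rewrite (mem_B42_even form_alt uv'_basis uv'1 z) f_coef.
- apply: lfun_img_eq => // z.
  rewrite (mem_B42_odd form_alt uv_basis uv1 (f z)).
  by rewrite (mem_B42_odd form_alt uv'_basis uv'1 z) f_coef.
Qed.

Lemma frame_grading_equivalent (G H : groupType) (g : G) (h : H) :
  (forall n, (n <= 4)%N -> (g ^+ n == 1)%g = (h ^+ n == 1)%g) ->
  @equivalent_gradings F (B42 form) (B42 form) G H
    (frame_grading form u' v' g) (frame_grading form u v h).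
Proof.
move=> eq_gh; exists f; split; first exact: change_frame_iso.
move=> k; rewrite /frame_grading basis_grading_eq0; last exact: frame_is_basis.
(* A nonzero component contains some i-th basis vector; its image is the component of the i-th
   vector of the other frame. *)
rewrite negbK => /codomP[i ->]; exists (frame_degree h i).
apply: lfun_img_eq => [|z]; first by case: change_frame_iso.
apply/(mem_frame_gradingP form_alt uv'_basis uv'1)/(mem_frame_gradingP
  form_alt uv_basis uv1).
  by move=> z_i j; rewrite f_coef -(eq_frame_degree _ _ eq_gh); apply: z_i.
by move=> z_i j; rewrite -f_coef (eq_frame_degree _ _ eq_gh); apply: z_i.
Qed.

End FrameEquivalence.

Section Support.

(** An injective f sends distinct nonzero components to distinct nonzero components, so the first
    grading has no more of them than the second. *)
Lemma equivalent_support_size (F : fieldType) (A B : superalgebra F)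
    (G H : groupType) (Gamma : G -> {vspace A}) (Delta : H -> {vspace B})
    (s : seq G) (t : seq H) :
  is_grading Gamma -> equivalent_gradings Gamma Delta ->
  uniq s -> {subset s <= gsupport Gamma} ->
  (forall h, Delta h != 0%VS -> h \in t) -> (size s <= size t)%N.
Proof.
move=> Gamma_grading [f [[f_bij _ _ _] f_hom]] s_uniq s_supp t_supp.
have f0 : lker f == 0%VS by apply/lker0P/bij_inj.
have img_neq0 g : g \in s -> (f @: Gamma g)%VS != 0%VS.
  move/s_supp; apply: contra => /eqP fg0; rewrite -subv0; apply/subvP => z z_g.
  have := memv_img f z_g; rewrite fg0 !memv0 => /eqP fz.
  by apply/eqP/(bij_inj f_bij); rewrite fz linear0.
rewrite -(size_map (fun g => (f @: Gamma g)%VS)) -(size_map Delta t).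
apply: uniq_leq_size.
  rewrite map_inj_in_uniq // => g h g_s h_s eq_gh.
  (* If two distinct components had the same image, it would be the image of their intersection,
     which is 0. *)
  apply: contra_neq_eq (img_neq0 g g_s) => ne_gh.
  rewrite -[LHS]capvv {2}eq_gh -lker0_img_cap //.
  by rewrite (grading_disjoint Gamma_grading ne_gh) limg0.
move=> _ /mapP[g g_s ->]; have [h fg] := f_hom g (s_supp g g_s).
by rewrite fg map_f // t_supp // -fg img_neq0.
Qed.

Variables (F : fieldType) (V : vectType F) (form : {biscalar V}).
Hypothesis form_alt : forall w, form w w = 0.
Variables u v : V.
Hypotheses (uv_basis : basis_of {:V} [:: u; v]) (uv1 : form u v = 1).

Definition frame_support (G : groupType) (g : G) : seq G :=
  undup [seq frame_degree g i | i <- iota 0 6].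

Lemma frame_grading_support (G : groupType) (g k : G) :
  (frame_grading form u v g k != 0%VS) = (k \in frame_support g).
Proof.
rewrite /frame_grading basis_grading_eq0; last exact: frame_is_basis.
rewrite negbK mem_undup -val_enum_ord -map_comp.
by apply/codomP/mapP => [[i ->]|[i _ ->]]; exists i; rewrite ?mem_enum.
Qed.

Lemma frame_grading_inequivalent (G H : groupType) (g : G) (h : H) :
  (size (frame_support h) < size (frame_support g))%N ->
  ~ @equivalent_gradings F (B42 form) (B42 form) G H
      (frame_grading form u v g) (frame_grading form u v h).
Proof.
rewrite ltnNge => /negP lt_hg eq_gh; apply: lt_hg.
apply: equivalent_support_size eq_gh _ _ _.
- exact: frame_is_grading.
- exact: undup_uniq.
- by move=> k; rewrite -frame_grading_support.
- by move=> k; rewrite frame_grading_support.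
Qed.

End Support.

(** * Universal groups *)

Section FrameUniversal.

Variables (F : fieldType) (V : vectType F) (form : {biscalar V}).
Hypothesis form_alt : forall w, form w w = 0.
Variables u v : V.
Hypotheses (uv_basis : basis_of {:V} [:: u; v]) (uv1 : form u v = 1).
Variables (G : groupType) (g : G).

Notation X := (frame form u v).
Notation Gamma := (frame_grading form u v g).

Let Gamma_grading : is_grading Gamma.
Proof. exact: frame_is_grading. Qed.

Lemma frame_mem (i : 'I_6) : X`_i \in Gamma (frame_degree g i).
Proof. by apply/mem_basis_grading/frame_is_basis. Qed.

Lemma frame_letter_subproof (i : 'I_6) : gsupport Gamma (frame_degree g i).
Proof.
rewrite /gsupport /= /frame_grading basis_grading_eq0; last exact: frame_is_basis.
by rewrite negbK (codom_f (fun j : 'I_6 => frame_degree g j)).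
Qed.

Definition frame_letter (i : 'I_6) : {k | gsupport Gamma k} :=
  Sub (frame_degree g i) (frame_letter_subproof i).

Lemma frame_support_rel (i j k : 'I_6) :
  (shifted_degree i + shifted_degree j = shifted_degree k + 2)%N ->
  sa_mul (X`_i : B42 form) X`_j != 0 ->
  support_rel Gamma (frame_degree g i) (frame_degree g j) (frame_degree g k).
Proof.
move=> eq_ijk ij_neq0; split; first by exists X`_i, X`_j; rewrite !frame_mem.
by move=> a b a_i b_j; rewrite -(frame_degreeM g eq_ijk) (grading_mul Gamma_grading).
Qed.

Lemma frame_support_rels :
  let rel i j k :=
    support_rel Gamma (frame_degree g i) (frame_degree g j) (frame_degree g k) in
  [/\ rel 0 0 0, rel 2 3 0 & [/\ rel 4 4 2, rel 5 5 3 & rel 4 5 0]].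
Proof.
have [m00 m23 [m44 m55 m45 _]] := frame_products form_alt uv_basis uv1.
pose o i (i6 : (i < 6)%N) := Ordinal i6.
have neq0 (i : 'I_6) : X`_i != 0 by apply: frame_neq0.
split; [| |split].
- apply: (@frame_support_rel (@o 0 isT) (@o 0 isT) (@o 0 isT)) => //.
  by rewrite m00 (neq0 (@o 0 isT)).
- apply: (@frame_support_rel (@o 2 isT) (@o 3 isT) (@o 0 isT)) => //.
  by rewrite m23 (neq0 (@o 0 isT)).
- apply: (@frame_support_rel (@o 4 isT) (@o 4 isT) (@o 2 isT)) => //.
  by rewrite m44 oppr_eq0 (neq0 (@o 2 isT)).
- apply: (@frame_support_rel (@o 5 isT) (@o 5 isT) (@o 3 isT)) => //.
  by rewrite m55 (neq0 (@o 3 isT)).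
(* The product u v is -e2, of index 1; index 0 stands for the same degree. *)
- apply: (@frame_support_rel (@o 4 isT) (@o 5 isT) (@o 0 isT)) => //.
  by rewrite m45 oppr_eq0 (neq0 (@o 1 isT)).
Qed.

Lemma val_frame_letter4 : val (frame_letter 4) = g.
Proof. by have [_ _ _ + _] := frame_degreeE g. Qed.

(** Only the letter of degree g needs checking: compatibility passes to that of e1 by idempotency,
    to v through u v, to x through u u, and to y through v v. *)
Lemma frame_universal_group (nf : G -> seq (letter Gamma))
    (s : {k | gsupport Gamma k}) :
  val s = g -> (forall k, eval_word (nf k) = k) -> univ_eq (nf 1%g) [::] ->
  nf_compatible nf s -> is_universal_group Gamma.
Proof.
move=> s_g nf_eval nf1 nf_s.
have nf4 : nf_compatible nf (frame_letter 4).
  suff <- : s = frame_letter 4 by [].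
  by apply: val_inj; rewrite val_frame_letter4.
apply: (universal_group_nf Gamma_grading nf_eval nf1).
have [r00 r23 [r44 r55 r45]] := frame_support_rels.
have nf0 := nf_compatible_idem Gamma_grading nf (s := frame_letter 0) r00.
have nf5 : nf_compatible nf (frame_letter 5).
  exact: (nf_compatible_divl Gamma_grading (s1 := frame_letter 4)
    (s2 := frame_letter 5) (s3 := frame_letter 0) r45).
have nf2 : nf_compatible nf (frame_letter 2).
  exact: (nf_compatible_mul Gamma_grading (s1 := frame_letter 4)
    (s2 := frame_letter 4) (s3 := frame_letter 2) r44).
have nf3 : nf_compatible nf (frame_letter 3).
  exact: (nf_compatible_mul Gamma_grading (s1 := frame_letter 5)
    (s2 := frame_letter 5) (s3 := frame_letter 3) r55).
have nf1' : nf_compatible nf (frame_letter 1).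
  suff <- : frame_letter 0 = frame_letter 1 by [].
  exact: val_inj.
have nf_letter (i j : 'I_6) : val i = val j ->
    nf_compatible nf (frame_letter j) -> nf_compatible nf (frame_letter i).
  by move=> /val_inj->.
move=> [k k_supp].
have /codomP[i k_i] : k \in codom (fun i : 'I_6 => frame_degree g i).
  have := k_supp; rewrite /gsupport /= /frame_grading basis_grading_eq0 ?negbK //.
  exact: frame_is_basis.
have -> : exist _ k k_supp = frame_letter i by apply: val_inj.
case: i {k_i} => -[|[|[|[|[|[|//]]]]]] i6.
- exact: nf_letter nf0.
- exact: nf_letter nf1'.
- exact: nf_letter nf2.
- exact: nf_letter nf3.
- exact: nf_letter nf4.
- exact: nf_letter nf5.
Qed.

End FrameUniversal.

(** * The listed gradings as frame gradings *)

Section ListedGradings.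

Variables (F : fieldType) (V : vectType F) (form : {biscalar V}).
Variables u v : V.

Lemma frame_gradingE (G : groupType) (g k : G) :
  let part i l := if frame_degree g i == k then l else 0%VS in
  frame_grading form u v g k =
  (part 0%N (line_e1 form u v) + (part 1%N (line_e2 form u v) +
  (part 2%N (line_x form u v) + (part 3%N (line_y form u v) +
  (part 4%N (line_u form u) + part 5%N (line_v form v))))))%VS.
Proof.
rewrite /frame_grading /basis_grading big_mkcond !big_ord_recl big_ord0 /=.
by rewrite addv0.
Qed.

(* The scope is needed in [1%R]: a bare [1] would be parsed in [group_scope], *)
(* as the neutral element, that is the integer 0.                             *)
Lemma B42_gradingZE :
  B42_gradingZ form u v = frame_grading form u v (1%R : Zgroup).
Proof.
apply: functional_extensionality => k.
rewrite frame_gradingE /=.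
have e c i : frame_degree (1%R : Zgroup) i = c ->
    (frame_degree (1%R : Zgroup) i == k) = (k == c :> int).
  by move=> ->; rewrite eq_sym.
rewrite (e 0 0%N) // ?(e 0 1%N) // (e 2 2%N) // (e (-2) 3%N) //.
rewrite (e 1 4%N) // (e (-1) 5%N) //.
rewrite /B42_gradingZ.
have [->|_] := eqVneq (k : int) 0; first by rewrite /= !addv0.
have [->|_] := eqVneq (k : int) 1; first by rewrite /= ?addv0 ?add0v.
have [->|_] := eqVneq (k : int) (-1); first by rewrite /= ?addv0 ?add0v.
have [->|_] := eqVneq (k : int) 2; first by rewrite /= ?addv0 ?add0v.
by case: eqVneq => _; rewrite /= ?addv0 ?add0v.
Qed.

Lemma B42_gradingZ4E :
  B42_gradingZ4 form u v = frame_grading form u v (1%R : 'Z_4).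
Proof.
apply: functional_extensionality => k.
rewrite frame_gradingE.
by case: k => -[|[|[|[|//]]]] ? /=; rewrite /B42_gradingZ4 /= ?addv0 ?add0v.
Qed.

Lemma B42_gradingZ3E :
  B42_gradingZ3 form u v = frame_grading form u v (1%R : 'Z_3).
Proof.
apply: functional_extensionality => k.
rewrite frame_gradingE.
case: k => -[|[|[|//]]] ? /=; rewrite /B42_gradingZ3 /= ?addv0 ?add0v //.
(* The frame lists x and y before u and v, the opposite of the order in [B42_gradingZ3]. *)
all: exact: addvC.
Qed.

End ListedGradings.

Lemma expgZ1 n : ((1%R : Zgroup) ^+ n)%g = n%:Z.
Proof. by elim: n => // n IHn; rewrite expgSr IHn -[RHS]/(Posz n.+1) -addn1. Qed.

Lemma expgZp1 n m : ((1%R : 'Z_n) ^+ m)%g = m%:R.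
Proof. by elim: m => // m IHm; rewrite expgSr IHm -[RHS]/(1 *+ m.+1) mulrSr. Qed.

Lemma eval_word_nseq (F : fieldType) (A : superalgebra F) (G : groupType)
    (Gamma : G -> {vspace A}) n (l : letter Gamma) :
  eval_word (nseq n l) = (eval_letter l ^+ n)%g.
Proof.
elim: n => [|n IHn]; first by rewrite /eval_word big_nil.
rewrite -[nseq _ _]/([:: l] ++ nseq n l) eval_word_cat IHn expgS.
by rewrite /eval_word big_seq1.
Qed.

Lemma cats1_nseq T n (x : T) : nseq n x ++ [:: x] = nseq n.+1 x.
Proof. by rewrite -addn1 nseqD. Qed.

(** * Normal forms for the cyclic groups *)

Section Universal.

Variables (F : fieldType) (V : vectType F) (form : {biscalar V}).
Hypothesis form_alt : forall w, form w w = 0.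
Variables u v : V.
Hypotheses (uv_basis : basis_of {:V} [:: u; v]) (uv1 : form u v = 1).

Lemma Z_frame_universal_group :
  is_universal_group (frame_grading form u v (1%R : Zgroup)).
Proof.
set Gamma := frame_grading _ _ _ _.
have [s s1] : exists s : {k | gsupport Gamma k}, val s = (1%R : Zgroup).
  exists (frame_letter form_alt uv_basis uv1 (1%R : Zgroup) 4); exact: val_frame_letter4.
pose nf (k : Zgroup) : seq (letter Gamma) :=
  match k : int with
  (* [Negz n] is -(n+1), hence the n+1 inverse letters in the second case. *)
  | Posz n => nseq n (false, s)
  | Negz n => nseq n.+1 (true, s)
  end.
apply: (frame_universal_group form_alt uv_basis uv1 (nf := nf) s1).
- case=> n; rewrite /nf eval_word_nseq /eval_letter /= [\val s]s1.
    exact: expgZ1.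
  by rewrite expVgn [in LHS]expgZ1.
- exact: univ_eq_refl.
- have nfS n : nf (Posz n) ++ [:: (false, s)] = nf (Posz n.+1).
    exact: cats1_nseq.
  have nfN n : univ_eq (nf (Negz n) ++ [:: (false, s)]) (nf (- (n%:Z))).
    have -> : nf (- n%:Z) = nseq n (true, s) by case: n.
    rewrite -[nf (Negz n)]cats1_nseq -catA -[X in univ_eq _ X]cats0.
    apply: univ_eq_cat; first exact: univ_eq_refl.
    exact: (univ_eq_cancel true s).
  case=> n; rewrite s1.
    rewrite nfS -addn1; exact: univ_eq_refl.
  have -> : ((Negz n : Zgroup) * 1%R)%g = - n%:Z.
    by rewrite -[LHS]/(Negz n + 1) NegzE -addn1 PoszD opprD addrNK.
  exact: nfN.
Qed.

(** With i copies of s as normal form of i, appending s is immediate except at the wrap-around from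
    n+1 to 0, which is the hypothesis. *)
Lemma Zp_frame_universal_group n
    (s := frame_letter form_alt uv_basis uv1 (1%R : 'Z_n.+2) 4) :
  univ_eq (nseq n.+2 (false, s)) [::] ->
  is_universal_group (frame_grading form u v (1%R : 'Z_n.+2)).
Proof.
have: val s = (1%R : 'Z_n.+2) by exact: val_frame_letter4.
move: s => s s1 s_n.
pose nf (i : 'Z_n.+2) := nseq i (false, s).
apply: (frame_universal_group form_alt uv_basis uv1 (nf := nf) s1); rewrite /nf.
- move=> i; rewrite eval_word_nseq /eval_letter /= [\val s]s1.
  by rewrite [LHS]expgZp1; exact: natr_Zp.
- exact: univ_eq_refl.
- move=> i; rewrite s1 cats1_nseq.
  have -> : (i * 1%R)%g = i + 1 :> 'Z_n.+2 by [].
  have -> : nat_of_ord (i + 1) = (i.+1 %% n.+2)%N.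
    by rewrite /= modnDmr addn1.
  have := ltn_ord i; rewrite -[Zp_trunc _]/n leq_eqVlt => /orP[/eqP[->]|lt_i].
    by rewrite modnn.
  by rewrite modn_small //; apply: univ_eq_refl.
Qed.

End Universal.

Section Cyclic.

Variables (F : fieldType) (V : vectType F) (form : {biscalar V}).
Hypothesis form_alt : forall w, form w w = 0.
Variables u v : V.
Hypotheses (uv_basis : basis_of {:V} [:: u; v]) (uv1 : form u v = 1).

Section Words.

Variables (G : groupType) (g : G).
Notation L i := (false, frame_letter form_alt uv_basis uv1 g i).

Lemma frame_letter0 : univ_eq [:: L 0] [::].
Proof.
have [r00 _ _] := frame_support_rels form_alt uv_basis uv1 g.
exact: univ_eq_idem.
Qed.

Lemma frame_letter44 : univ_eq [:: L 4; L 4] [:: L 2].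
Proof.
have [_ _ [r44 _ _]] := frame_support_rels form_alt uv_basis uv1 g.
exact: univ_eq_rel.
Qed.

Lemma frame_letter45 : univ_eq [:: L 4; L 5] [::].
Proof.
have [_ _ [_ _ r45]] := frame_support_rels form_alt uv_basis uv1 g.
by apply: univ_eq_trans frame_letter0; apply: univ_eq_rel.
Qed.

Lemma frame_letter23 : univ_eq [:: L 2; L 3] [::].
Proof.
have [_ r23 _] := frame_support_rels form_alt uv_basis uv1 g.
by apply: univ_eq_trans frame_letter0; apply: univ_eq_rel.
Qed.

End Words.

Lemma Z2_frame_universal_group :
  is_universal_group (frame_grading form u v (1%R : 'Z_2)).
Proof.
apply: (@Zp_frame_universal_group _ _ _ form_alt _ _ uv_basis uv1 0).
apply: univ_eq_trans (frame_letter0 _).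
(* As 2 = 0 in Z_2, x shares the letter of e1, and u u gives it. *)
have -> : frame_letter form_alt uv_basis uv1 (1%R : 'Z_2) 0
        = frame_letter form_alt uv_basis uv1 (1%R : 'Z_2) 2.
  exact/val_inj/eqP.
exact: frame_letter44.
Qed.

Lemma Z3_frame_universal_group :
  is_universal_group (frame_grading form u v (1%R : 'Z_3)).
Proof.
apply: (@Zp_frame_universal_group _ _ _ form_alt _ _ uv_basis uv1 1).
apply: univ_eq_trans (frame_letter45 _).
(* As -1 = 2 in Z_3, v shares the letter of x, so u u u = u x = u v = 1 on letters. *)
have -> : frame_letter form_alt uv_basis uv1 (1%R : 'Z_3) 5
        = frame_letter form_alt uv_basis uv1 (1%R : 'Z_3) 2.
  exact/val_inj/eqP.
exact: univ_eq_cat (univ_eq_refl [:: _]) (frame_letter44 _).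
Qed.

Lemma Z4_frame_universal_group :
  is_universal_group (frame_grading form u v (1%R : 'Z_4)).
Proof.
apply: (@Zp_frame_universal_group _ _ _ form_alt _ _ uv_basis uv1 2).
apply: univ_eq_trans (frame_letter23 _).
(* As -2 = 2 in Z_4, y shares the letter of x, so u u u u = x x = x y = 1 on letters. *)
have -> : frame_letter form_alt uv_basis uv1 (1%R : 'Z_4) 3
        = frame_letter form_alt uv_basis uv1 (1%R : 'Z_4) 2.
  exact/val_inj/eqP.
exact: univ_eq_cat (frame_letter44 _) (frame_letter44 _).
Qed.

End Cyclic.

(** * Classification *)

Section Classification.

Variables (F : fieldType) (V : vectType F) (form : {biscalar V}).
Hypothesis dimV : \dim {:V} = 2%N.
Hypothesis form_alt : forall w, form w w = 0.
Variables u v : V.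
Hypotheses (uv_basis : basis_of {:V} [:: u; v]) (uv1 : form u v = 1).

Lemma B42_gradingZ2E :
  B42_gradingZ2 form = frame_grading form u v (1%R : 'Z_2).
Proof.
apply: functional_extensionality => k; apply/vspaceP => z.
case: k => -[|[|//]] k2; rewrite /B42_gradingZ2 /=.
  rewrite (mem_B42_even form_alt uv_basis uv1); apply/idP/idP.
    move=> /and3P[/eqP z4 /eqP z5 _]; apply/mem_frame_gradingP => //.
    by case=> -[|[|[|[|[|[|//]]]]]] ? //=.
  move=> /(mem_frame_gradingP form_alt uv_basis uv1) z0.
  by apply/and3P; split=> //; apply/eqP; [exact: (z0 4) | exact: (z0 5)].
rewrite (mem_B42_odd form_alt uv_basis uv1); apply/idP/idP.
  case/and5P=> /eqP z0 /eqP z1 /eqP z2 /eqP z3 _; apply/mem_frame_gradingP => //.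
  by case=> -[|[|[|[|[|[|//]]]]]] ? //=.
move=> /(mem_frame_gradingP form_alt uv_basis uv1) z0.
by apply/and5P; split=> //; apply/eqP;
  [exact: (z0 0) | exact: (z0 1) | exact: (z0 2) | exact: (z0 3)].
Qed.

Variables (G : groupType) (Gamma : G -> {vspace B42 form}).
Hypothesis Gamma_super : is_super_grading Gamma.

Let Gamma_grading : is_grading Gamma.
Proof. by case: Gamma_super. Qed.

Lemma super_grading_odd_part g (z : B42 form) :
  z \in Gamma g -> (B42_inV z.2 : B42 form) \in Gamma g.
Proof.
rewrite {1}(super_grading_full Gamma_super) => /memv_addP[a + [b + ->]].
rewrite !memv_cap => /andP[_ /B42_evenP/= a2] /andP[b_g /B42_oddP/= b1].
suff -> : B42_inV (a + b).2 = b :> B42 form by [].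
by apply: injective_projections; rewrite /= ?a2 ?add0r ?b1.
Qed.

Lemma odd_homogeneous_sum (w : V) :
  exists n (h : 'I_n -> G) (p : 'I_n -> V),
    w = \sum_i p i /\ forall i, (B42_inV (p i) : B42 form) \in Gamma (h i).
Proof.
have [s /andP[_]] := grading_full Gamma_grading (B42_inV w).
rewrite big_tnth => /memv_sumP[a a_s w_a].
exists (size s), (tnth (in_tuple s)), (fun i => (a i).2); split=> [|i].
  have -> : w = (B42_inV w : B42 form).2 by [].
  by rewrite w_a (raddf_sum (snd : ('End(V) * V)%type -> V)).
exact/super_grading_odd_part/a_s.
Qed.

(** Since 1 = (u, v) is the sum of all (p_i, q_j) over odd homogeneous components of u and v, some
    term is nonzero; rescaling q_j makes it 1. *)
Lemma odd_homogeneous_frame : exists u' v' g h,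
  [/\ form u' v' = 1, (B42_inV u' : B42 form) \in Gamma g
    & (B42_inV v' : B42 form) \in Gamma h].
Proof.
have [m [g [p [u_p p_g]]]] := odd_homogeneous_sum u.
have [n [h [q [v_q q_h]]]] := odd_homogeneous_sum v.
have [/existsP[i /existsP[j ij_neq0]]|] :=
  boolP [exists i, exists j, form (p i) (q j) != 0].
  exists (p i), ((form (p i) (q j))^-1 *: q j), (g i), (h j).
  split=> //; first by rewrite linearZr_LR /= mulVf.
  have -> : B42_inV ((form (p i) (q j))^-1 *: q j)
          = (form (p i) (q j))^-1 *: (B42_inV (q j) : B42 form).
    by rewrite linearZ.
  exact: memvZ.
move=> /existsPn form0; have /eqP := uv1; rewrite u_p linear_sumlz big1 => [|i _].
  by rewrite eq_sym oner_eq0.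
rewrite v_q linear_sumr big1 // => j _; apply/eqP.
by have /existsPn/(_ j) := form0 i; rewrite negbK.
Qed.

(** The idempotent e1 = v' u' has degree h g and also (h g)^2, so h = g^-1; the products of u' and
    v' then place the whole frame, which determines the grading. *)
Lemma super_grading_frame : exists u' v' g,
  [/\ basis_of {:V} [:: u'; v'], form u' v' = 1
    & Gamma = frame_grading form u' v' g].
Proof.
have [u' [v' [g [h [uv'1 u_g v_h]]]]] := odd_homogeneous_frame.
have uv'_basis := symplectic_basis dimV form_alt uv'1.
exists u', v', g; split=> //; apply: functional_extensionality.
have X_basis := frame_is_basis form_alt uv'_basis uv'1.
have [m00 _ [m44 m55 m45 m54]] := frame_products form_alt uv'_basis uv'1.
have in_mul k l := @grading_mul _ _ _ _ Gamma_grading k l.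
have e1_hg : (frame form u' v')`_0 \in Gamma (h * g)%g by rewrite -m54 in_mul.
have hg1 : (h * g = 1)%g.
  apply: (mulgI (h * g)%g); rewrite mulg1.
  have e1_hghg : (frame form u' v')`_0 \in Gamma (h * g * (h * g))%g.
    by rewrite -m00 in_mul.
  apply: grading_degree_inj e1_hghg e1_hg _ => //.
  exact: (frame_neq0 form_alt uv'_basis uv'1 ord0).
have h_g : h = (g^-1)%g by apply/eqP; rewrite -[h](mulgK g) hg1 mul1g.
apply: grading_of_basis => //.
have [d0 d2 d3 d4 d5] := frame_degreeE g.
case=> -[|[|[|[|[|[|//]]]]]] i6; rewrite [val _]/=.
- by rewrite d0 -hg1.
- rewrite -[frame_degree g _]/(frame_degree g 0) d0 -(mulgV g) -h_g.
  by rewrite -memvN -m45 in_mul.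
- by rewrite d2 -memvN -m44 in_mul.
- by rewrite d3 invMg -h_g -m55 in_mul.
- by rewrite d4.
- by rewrite d5 -h_g.
Qed.

End Classification.

Theorem theorem15 (F : fieldType) (charF : 3%N \in [pchar F])
    (V : vectType F) (dimV : \dim {:V} = 2%N)
    (form : {biscalar V})
    (form_alternating : forall w, form w w = 0)
    (form_nondegenerate : forall w, (forall w', form w w' = 0) -> w = 0)
    (u v : V) (uv_basis : basis_of {:V} [:: u; v]) (uv1 : form u v = 1) :
  let Ga := B42_gradingZ form u v in
  let Gb := B42_gradingZ4 form u v in
  let Gc := B42_gradingZ3 form u v in
  let Gd := B42_gradingZ2 form in
  (* each of the four is a nontrivial grading by its universal group *)
  [/\ [/\ is_super_grading Ga, abelian_support Ga, ~ trivial_grading Ga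
        & is_universal_group Ga],
      [/\ is_super_grading Gb, abelian_support Gb, ~ trivial_grading Gb
        & is_universal_group Gb],
      [/\ is_super_grading Gc, abelian_support Gc, ~ trivial_grading Gc
        & is_universal_group Gc]
    & [/\ is_super_grading Gd, abelian_support Gd, ~ trivial_grading Gd
        & is_universal_group Gd]] /\
  (* they are pairwise inequivalent *)
  ([/\ ~ equivalent_gradings Ga Gb, ~ equivalent_gradings Ga Gc
     & ~ equivalent_gradings Ga Gd] /\
   [/\ ~ equivalent_gradings Gb Gc, ~ equivalent_gradings Gb Gd
     & ~ equivalent_gradings Gc Gd]) /\
  (* every nontrivial grading is equivalent to one of them *)
  (forall (G : groupType) (Gamma : G -> {vspace B42 form}),
     is_super_grading Gamma -> abelian_support Gamma ->
     ~ trivial_grading Gamma ->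
     [\/ equivalent_gradings Gamma Ga, equivalent_gradings Gamma Gb,
         equivalent_gradings Gamma Gc | equivalent_gradings Gamma Gd]).
Proof.
move=> Ga Gb Gc Gd.
have -> : Ga = frame_grading form u v (1%R : Zgroup) by exact: B42_gradingZE.
have -> : Gb = frame_grading form u v (1%R : 'Z_4) by exact: B42_gradingZ4E.
have -> : Gc = frame_grading form u v (1%R : 'Z_3) by exact: B42_gradingZ3E.
have -> : Gd = frame_grading form u v (1%R : 'Z_2) by exact: B42_gradingZ2E.
split; [|split; [|move=> G Gamma Gamma_super _ Gamma_nontrivial]].
- have super (G : groupType) (g : G) :
    is_super_grading (frame_grading form u v g) by exact: frame_is_super_grading.
  have nontriv (G : groupType) (g : G) :
    g != 1%g -> ~ trivial_grading (frame_grading form u v g).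
    exact: frame_grading_nontrivial.
  split; split; try exact: super; try exact: nontriv.
  + by move=> g h _ _; apply: addrC.
  + exact: Z_frame_universal_group.
  + by move=> g h _ _; apply: addrC.
  + exact: Z4_frame_universal_group.
  + by move=> g h _ _; apply: addrC.
  + exact: Z3_frame_universal_group.
  + by move=> g h _ _; apply: addrC.
  + exact: Z2_frame_universal_group.
(* The supports have 5, 4, 3 and 2 elements, compared by computation. *)
- by split; split; apply: frame_grading_inequivalent.
have [u' [v' [g [uv'_basis uv'1 Gamma_g]]]] :=
  super_grading_frame dimV form_alternating uv1 Gamma_super.
have equiv (H : groupType) (h : H) :
    (forall n, (n <= 4)%N -> (g ^+ n == 1)%g = (h ^+ n == 1)%g) ->
    equivalent_gradings Gamma (frame_grading form u v h).
  by rewrite Gamma_g; apply: frame_grading_equivalent.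
(* If g = 1, all six basis vectors have degree 1 and the grading is trivial. *)
have g1 : g != 1%g.
  apply: contra_notN Gamma_nontrivial => /eqP g1.
  apply/vspaceP => z; rewrite memvf Gamma_g.
  apply/(mem_frame_gradingP form_alternating uv'_basis uv'1) => i.
  by rewrite /frame_degree g1 !expg1n invg1 mulg1 eqxx.
have powers (H : groupType) (h : H) :
    h != 1%g -> (g ^+ 2 == 1)%g = (h ^+ 2 == 1)%g ->
    (g ^+ 3 == 1)%g = (h ^+ 3 == 1)%g -> (g ^+ 4 == 1)%g = (h ^+ 4 == 1)%g ->
    equivalent_gradings Gamma (frame_grading form u v h).
  move=> h1 e2 e3 e4; apply: equiv => -[|[|[|[|[|//]]]]] _ //.
    by rewrite !expg0 !eqxx.
  by rewrite !expg1 (negPf g1) (negPf h1).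
(* The order of g decides: 2, 3 and 4 give Z_2, Z_3 and Z_4. *)
have [g2|g2] := eqVneq (g ^+ 2)%g 1%g.
  have g3 : (g ^+ 3 == 1)%g = false by rewrite expgS g2 mulg1 (negPf g1).
  have g4 : (g ^+ 4 == 1)%g by rewrite (expgnA g 2 2) g2 expg1n.
  by constructor 4; apply: powers; rewrite ?g2 ?g3 ?g4 ?eqxx.
have [g3|g3] := eqVneq (g ^+ 3)%g 1%g.
  have g4 : (g ^+ 4 == 1)%g = false by rewrite expgS g3 mulg1 (negPf g1).
  by constructor 3; apply: powers; rewrite ?(negPf g2) ?g3 ?g4 ?eqxx.
have [g4|g4] := eqVneq (g ^+ 4)%g 1%g.
  by constructor 2; apply: powers; rewrite ?(negPf g2) ?(negPf g3) ?g4 ?eqxx.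
(* Here g may have finite order above 4: its five degrees are still distinct, as in the
   Z-grading. *)
by constructor 1; apply: powers; rewrite ?(negPf g2) ?(negPf g3) ?(negPf g4).
Qed.
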